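(* Let $A\subset\mathbb{R}^d$ be a finite point configuration which affinely spans $\mathbb{R}^d$, and let $\omega:A\to\mathbb{R}$ be an arbitrary height function. Then the tight span $T(A,\omega)$ of the regular subdivision of $A$ induced by $\omega$ is collapsible.
   Context: The dome of $A$ with respect to $\omega$ is the polyhedron $D(A,\omega)=\{(x,s)\in\mathbb{R}^d\times\mathbb{R} : s\le \min_{u\in A}(\omega(u)+\langle u,x\rangle)\}\subset\mathbb{R}^{d+1}$. The tight span $T(A,\omega)$ is the polytopal complex in $\mathbb{R}^d$ obtained as the image, under the orthogonal projection $\mathbb{R}^{d+1}\to\mathbb{R}^d$ forgetting the last coordinate, of the bounded faces of $D(A,\omega)$ (it need not be pure). (It is dual to the regular subdivision of $A$ induced by $\omega$, i.e. the subdivision whose cells are the projections of the lower faces of $\mathrm{conv}\{(u,\omega(u)):u\in A\}+\mathbb{R}_{\ge0}e_{d+1}$.) For a regular cell complex $\Sigma$, its Hasse diagram $\mathcal{H}(\Sigma)$ is the directed graph with one node per cell and an arc $(\sigma,\tau)$ whenever $\sigma$ is a maximal cell of the boundary $\partial\tau$. An acyclic matching is a matching $\mu$ of the edges of $\mathcal{H}(\Sigma)$ such that reversing the arcs in $\mu$ creates no directed cycle; a cell is critical if it is not covered by $\mu$. $\Sigma$ is collapsible if $\mathcal{H}(\Sigma)$ admits an acyclic matching with exactly one critical cell. *)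

(* Defs.v *)
From Stdlib Require Export Relation_Operators.
From HB Require Export structures.
From mathcomp Require Export all_boot all_order all_algebra finmap.
From mathcomp Require Export all_classical all_reals topology normedtype.
Export numFieldNormedType.Exports.

Set Implicit Arguments.
Unset Strict Implicit.
Unset Printing Implicit Defensive.

Import Order.TTheory GRing.Theory Num.Theory.

Local Open Scope classical_set_scope.
Local Open Scope ring_scope.

Definition dotp {R : realType} {d : nat} (u x : 'rV[R]_d) : R :=
  \sum_(i < d) u 0 i * x 0 i.

Definition affinely_spans {R : realType} {d : nat} (A : {fset 'rV[R]_d}) : Prop :=
  forall x : 'rV[R]_d, exists c : A -> R,
    \sum_(u : A) c u = 1 /\ x = \sum_(u : A) c u *: val u.

Definition dome {R : realType} {d : nat} (A : {fset 'rV[R]_d}) (omega : A -> R) :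
    set ('rV[R]_d * R) :=
  [set p | forall u : A, p.2 <= omega u + dotp (val u) p.1].

(* Faces are cut out by valid inequalities [l p <= b].  The choices [l = 0] with
   [b = 0] and [b = 1] yield the improper faces [P] and [set0]. *)
Definition is_face {R : realType} {V : lmodType R} (P F : set V) : Prop :=
  exists (l : {scalar V}) (b : R),
    (forall p, P p -> l p <= b) /\ F = [set p | P p /\ l p = b].

(* The tight span is represented by its set of closed cells; the empty face is
   not a cell. *)
Definition tight_span {R : realType} {d : nat} (A : {fset 'rV[R]_d})
    (omega : A -> R) : set (set 'rV[R]_d) :=
  [set sigma | exists F : set ('rV[R]_d * R),
     [/\ is_face (dome omega) F, F !=set0, bounded_set F & sigma = fst @` F]].

Section CellComplex.
Context {T : Type}.
Implicit Types (Sigma : set (set T)) (sigma tau : set T).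

(* In a regular cell complex given by its closed cells, the boundary of a cell
   is the subcomplex of the cells strictly contained in it. *)
Definition boundary Sigma tau : set (set T) :=
  [set sigma | Sigma sigma /\ sigma `<` tau].

Definition hasse Sigma : set (set T * set T) :=
  [set a | [/\ Sigma a.2, boundary Sigma a.2 a.1 &
     forall rho, boundary Sigma a.2 rho -> ~ (a.1 `<` rho)]].

End CellComplex.

Section Matching.
Context {N : Type}.
Implicit Types (E mu : set (N * N)).

Definition incident (a : N * N) (x : N) : Prop := a.1 = x \/ a.2 = x.

Definition is_matching E mu : Prop :=
  mu `<=` E /\
  forall a b x, mu a -> mu b -> incident a x -> incident b x -> a = b.

Definition reverse_arcs E mu : set (N * N) :=
  [set a | (E a /\ ~ mu a) \/ mu (a.2, a.1)].

Definition acyclic E : Prop :=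
  forall x, ~ clos_trans N (fun y z => E (y, z)) x x.

Definition acyclic_matching E mu : Prop :=
  is_matching E mu /\ acyclic (reverse_arcs E mu).

End Matching.

Definition critical {T : Type} (Sigma : set (set T)) (mu : set (set T * set T))
    (sigma : set T) : Prop :=
  Sigma sigma /\ forall a, mu a -> ~ incident a sigma.

Definition collapsible {T : Type} (Sigma : set (set T)) : Prop :=
  exists mu : set (set T * set T),
    acyclic_matching (hasse Sigma) mu /\
    exists! sigma : set T, critical Sigma mu sigma.

(* Main.v *)
Require Import Defs.
From mathcomp Require Import ring lra.

(** The homogenized dome is a polyhedral cone whose faces are encoded by their
sets of tight inequalities, and the bounded faces are those on which the
homogenizing coordinate [h] is positive away from the lineality space. For an
arbitrary linear form [h] that is positive somewhere on the cone, fix a ray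
with tight set [J0] on which [h > 0], and let [g] be minus the sum of the
inequalities in [J0]: thus [g <= 0], with equality exactly on the ray. On a
bounded face, [g / h] attains a minimum [c], precisely along some bounded face
[G]; the bounded faces that share the same [G] are the bounded faces of the
quotient cone at [G] with respect to the form [g - c h]. Passing to this
quotient just means keeping the inequalities that are tight on [G], so
induction on the number of inequalities decomposes each of these fibres,
except that of the ray itself, into elementary collapses. The fibres are
stacked by decreasing [c], and only the vertex given by the ray is left over.
*)

Set Implicit Arguments.
Unset Strict Implicit.
Unset Printing Implicit Defensive.

Import Order.TTheory GRing.Theory Num.Theory.
Local Open Scope ring_scope.

(** * Elementary collapses and acyclic matchings *)

Section Collapse.
Context {I : finType}.
Implicit Types (S : {set {set I}}) (r s t J G : {set I}).

(* The elements are faces encoded by tight sets, so reverse inclusion is the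
   face order: [s] is a proper face of [t], and of no cell of [S]. *)
Inductive collapses : {set {set I}} -> Prop :=
| collapses0 : collapses finset.set0
| collapsesU S s t : collapses S -> t \proper s ->
    (forall r, r \in S -> ~~ (r \subset s)) -> collapses (s |: (t |: S)).

Lemma collapses_pair s t : t \proper s -> collapses [set s; t].
Proof.
move=> ts; rewrite -[X in collapses X]finset.setU0 -finset.setUA.
by apply: collapsesU => //; [exact: collapses0 | move=> r; rewrite inE].
Qed.

(** The pairs of [S2] are removed first: no cell of [S1] has a face in [S2], so these pairs stay
    free in the presence of [S1]. *)
Lemma collapses_cat S1 S2 : collapses S1 -> collapses S2 ->
  (forall r s, r \in S1 -> s \in S2 -> ~~ (r \subset s)) ->
  collapses (S1 :|: S2).
Proof.
move=> c1; elim=> {S2} [|S2 s t c2 IH ts free] H.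
  by rewrite finset.setU0.
rewrite (finset.setUCA S1 [set s]) (finset.setUCA S1 [set t]).
apply: collapsesU => //.
  by apply: IH => r s' rS sS; apply: H => //; rewrite !inE sS !orbT.
move=> r; rewrite inE => /orP[rS|/free//].
by apply: H => //; rewrite !inE eqxx.
Qed.

(** The first fibre to be removed is that of the [G] with least [c] and, among those, of least
    cardinality; the second hypothesis then forbids a cell of another fibre to have a face in it. *)
Lemma collapses_bigcup (R : realDomainType) (U : {set {set I}})
    (fib : {set I} -> {set {set I}}) (c : {set I} -> R) :
  (forall G, G \in U -> collapses (fib G)) ->
  (forall G1 G2 r s, G1 \in U -> G2 \in U -> r \in fib G1 -> s \in fib G2 ->
     r \subset s -> c G2 <= c G1 -> c G1 = c G2 /\ G1 \subset G2) ->
  collapses (\bigcup_(G in U) fib G).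
Proof.
have [n leUn] := ubnP #|U|; elim: n => // n IHn in U leUn *.
move=> cU ord; have [->|[G0 G0U]] := set_0Vmem U.
  by rewrite big_set0; exact: collapses0.
case: (Order.TotalTheory.arg_minP c G0U) => G1 /= G1U minG1.
have {}G1U : G1 \in U := G1U.
have G1P : (G1 \in U) && (c G1 == c G1) by rewrite G1U eqxx.
case: (@arg_minnP _ G1 (fun G => (G \in U) && (c G == c G1))
  (fun G => #|G|) G1P).
move=> G /andP[GU /eqP cG] minG.
rewrite (big_setD1 G GU) /= finset.setUC; apply: collapses_cat.
- apply: IHn.
  + by move: leUn; rewrite (cardsD1 G) GU.
  + by move=> G' /setD1P[_ /cU].
  + by move=> G' G'' r s /setD1P[_ ?] /setD1P[_ ?]; apply: ord.
- exact: cU.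
move=> r s /finset.bigcupP[G2 /setD1P[G2G G2U] rG2] sG; apply/negP => rs.
have [cG2 subG] : c G2 = c G /\ G2 \subset G.
  by apply: (ord G2 G r s) => //; rewrite cG minG1.
have /minG : (G2 \in U) && (c G2 == c G1) by rewrite G2U cG2 cG eqxx.
by move=> cardG; move: G2G; rewrite eqEcard subG cardG.
Qed.

(** Here [mu s t] pairs a facet [s] with its cell [t]. The potential [pot] certifies acyclicity:
    within [S] it increases along every arc once the matched arcs are reversed. *)
Lemma collapses_matching S : collapses S ->
  exists (mu : {set I} -> {set I} -> Prop) (pot : {set I} -> nat) (N : nat),
  [/\ forall s t, mu s t -> [/\ s \in S, t \in S, t \proper s,
        pot t < pot s & forall r, r \in S -> t \proper r -> ~~ (r \proper s)]%N,
      forall r, r \in S -> exists s, mu r s \/ mu s r,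
      forall s t s' t', mu s t -> mu s' t' ->
        [|| s == s', s == t', t == s' | t == t'] -> s = s' /\ t = t',
      forall r s, r \in S -> s \in S -> r \proper s -> ~ mu s r ->
        (pot s < pot r)%N &
      forall r, r \in S -> (pot r < N)%N].
Proof.
elim=> {S} [|S s0 t0 cS [mu [pot [N [H1 H2 H3 H4 H5]]]] ts free].
  exists (fun _ _ => False), (fun _ => 0%N), 0%N.
  by split=> // r; rewrite inE.
have s0S : s0 \notin S by apply/negP => /free; rewrite subxx.
have t0S : t0 \notin S by apply/negP => /free; rewrite proper_sub.
have ts0 : t0 != s0 by apply: contraTneq ts => ->; rewrite fintype.properxx.
have freet r : r \in S -> ~~ (r \subset t0).
  move=> /free; apply: contra => rt.
  exact: fintype.subset_trans rt (proper_sub ts).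
(* The new pair receives the two largest values, with [t0] below [s0] because the arc between them
   is reversed. *)
exists (fun s t => mu s t \/ (s = s0 /\ t = t0)),
  (fun r => if r == s0 then N.+1 else if r == t0 then N else pot r), N.+2.
have potS r : r \in S ->
    (if r == s0 then N.+1 else if r == t0 then N else pot r) = pot r.
  move=> rS; case: eqP => [e|_]; first by rewrite -e rS in s0S.
  by case: eqP => // e; rewrite -e rS in t0S.
split.
- move=> s t [/H1[sS tS pts lts btw]|[-> ->]].
    rewrite !inE sS tS !orbT; split => //; first by rewrite !potS.
    move=> r; rewrite !inE => /or3P[/eqP->|/eqP->|]; last exact: btw.
      by move=> /proper_sub tr; have := free _ tS; rewrite tr.
    by move=> /proper_sub tr; have := freet _ tS; rewrite tr.
  rewrite !inE !eqxx orbT (negPf ts0) /=; split => // r.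
  rewrite !inE => /or3P[/eqP->|/eqP->|rS].
  + by rewrite fintype.properxx.
  + by rewrite fintype.properxx.
  + by move=> _; apply: contra (free _ rS); exact: proper_sub.
- move=> r; rewrite !inE => /or3P[/eqP->|/eqP->|/H2].
  + by exists t0; left; right.
  + by exists s0; right; right.
  + by case=> s [|]; exists s; [left|right]; left.
- move=> s t s' t' [m|[-> ->]] [m'|[-> ->]] //; first exact: H3.
  + have [sS tS _ _ _] := H1 _ _ m.
    case/or4P=> /eqP e; subst; first [by rewrite sS in s0S|by rewrite sS in t0S
     |by rewrite tS in s0S|by rewrite tS in t0S].
  + have [sS tS _ _ _] := H1 _ _ m'.
    case/or4P=> /eqP e; subst; first [by rewrite sS in s0S|by rewrite sS in t0S
     |by rewrite tS in s0S|by rewrite tS in t0S].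
- move=> r s; rewrite !inE => /or3P[/eqP->|/eqP->|rS] /or3P[/eqP->|/eqP->|sS].
  + by rewrite fintype.properxx.
  + by move/proper_sub; rewrite fintype.properE in ts; case/andP: ts => _ /negP.
  + rewrite eqxx => _ _; rewrite potS //; exact: leq_trans (H5 _ sS) _.
  + by move=> _ []; right.
  + by rewrite fintype.properxx.
  + by rewrite eqxx (negPf ts0) => _ _; rewrite potS //; exact: H5.
  + by move/proper_sub => rs; have := free _ rS; rewrite rs.
  + by move/proper_sub => rs; have := freet _ rS; rewrite rs.
  + move=> rs nm; rewrite !potS //; apply: H4 => // m.
    by apply: nm; left.
- move=> r; rewrite !inE => /or3P[/eqP->|/eqP->|rS].
  + by rewrite eqxx.
  + by rewrite eqxx (negPf ts0).
  + by rewrite potS // ltnW // ltnW // ltnS; exact: H5.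
Qed.

(** Since [phi] reverses the order, the matching of tight sets transports to cells. The cell of [J0]
    has no proper face and stays critical. *)
Lemma collapsible_of_collapses (T : Type) (Sigma : set (set T))
    (phi : {set I} -> set T) S J0 :
  J0 \in S -> collapses (S :\ J0) ->
  (forall J, J \in S -> J0 \subset J -> J = J0) ->
  (forall J J', J \in S -> J' \in S ->
     (phi J `<=` phi J')%classic <-> J' \subset J) ->
  (forall sigma, Sigma sigma <-> exists2 J, J \in S & sigma = phi J) ->
  collapsible Sigma.
Proof.
move=> J0S cS minJ0 phiP SigmaP.
have inj J J' : phi J = phi J' -> J \in S -> J' \in S -> J = J'.
  move=> e JS J'S; apply/eqP; rewrite finset.eqEsubset.
  by apply/andP; split; apply/phiP => //; rewrite e.
have prop J J' : J \in S -> J' \in S ->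
    (phi J `<` phi J')%classic <-> J' \proper J.
  move=> JS J'S; rewrite fintype.properE; split.
    move=> [/phiP -> //= nsub]; apply/negP => sub; apply: nsub.
    exact/phiP.
  case/andP=> /phiP sub /negP nsub; split; first exact: sub.
  by move/phiP => /(_ J'S JS).
have [mu [pot [N [H1 H2 H3 H4 _]]]] := collapses_matching cS.
have SD J : J \in S :\ J0 -> J \in S by case/setD1P.
pose m : set (set T * set T) :=
  fun e => exists s t, mu s t /\ e = (phi s, phi t).
(* No arc ends in [J0], so it can take the least value; the other potentials shift by one to make
   room. *)
pose pot' J := if J == J0 then 0%N else (pot J).+1.
exists m; split; last first.
  exists (phi J0); split.
    split; first by apply/SigmaP; exists J0.
    move=> _ [s [t [/H1[sS tS _ _ _] ->]]] [] /= e.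
      by have := sS; rewrite (inj _ _ e (SD _ sS) J0S) setD11.
    by have := tS; rewrite (inj _ _ e (SD _ tS) J0S) setD11.
  move=> sigma [/SigmaP[J JS ->] crit]; congr phi; apply/eqP.
  rewrite eq_sym; apply: contraT => JJ0.
  have : J \in S :\ J0 by rewrite !inE JJ0.
  case/H2 => s [Js|sJ]; exfalso.
    by apply: (crit (phi J, phi s)); [exists J, s|left].
  by apply: (crit (phi s, phi J)); [exists s, J|right].
split.
  split=> [_ [s [t [/H1[sS tS ts _ btw] ->]]]|].
    split => /=.
    + by apply/SigmaP; exists t => //; exact: SD.
    + split; first by apply/SigmaP; exists s => //; exact: SD.
      by apply/prop => //; exact: SD.
    + move=> rho [/SigmaP[r rS ->]] /prop rt /prop sr.
      have {}rt := rt rS (SD _ tS); have {}sr := sr (SD _ sS) rS.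
      have [e|rJ0] := eqVneq r J0.
        move: sr; rewrite e => /proper_sub /minJ0 e'.
        by have := sS; rewrite e' ?setD11 // SD.
      have rS' : r \in S :\ J0 by rewrite !inE rJ0.
      by have := btw _ rS' rt; rewrite sr.
  move=> _ _ x [s [t [st ->]]] [s' [t' [st' ->]]] i1 i2.
  have [/SD sS /SD tS _ _ _] := H1 _ _ st.
  have [/SD sS' /SD tS' _ _ _] := H1 _ _ st'.
  suff: s = s' /\ t = t' by case=> -> ->.
  apply: H3 => //.
  by case: i1 i2 => /= <- [] /= /inj -> //; rewrite eqxx ?orbT.
pose arc y z := reverse_arcs (hasse Sigma) m (y, z).
have arcP y z : arc y z -> exists J J',
    [/\ J \in S, J' \in S, y = phi J, z = phi J' & (pot' J < pot' J')%N].
  case=> [[[/= /SigmaP[J' J'S ->] [/SigmaP[J JS ->] /prop lt] _] nm]|].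
    exists J, J'; split => //.
    have {}lt := lt JS J'S.
    rewrite /pot'; have [e|J'J0] := eqVneq J' J0.
      move: (lt); rewrite e => /proper_sub /minJ0 eJ.
      by move: lt; rewrite e eJ // fintype.properxx.
    case: eqVneq => // JJ0; rewrite ltnS; apply: H4; rewrite ?inE ?JJ0 ?J'J0 //.
    by move=> mm; apply: nm; exists J, J'.
  move=> /= [s [t [st [-> ->]]]]; have [sS tS _ lt _] := H1 _ _ st.
  exists t, s; split; rewrite ?SD // /pot'.
  by case/setD1P: sS => /negPf -> _; case/setD1P: tS => /negPf -> _.
have pathP y z : clos_trans _ arc y z -> exists J J',
    [/\ J \in S, J' \in S, y = phi J, z = phi J' & (pot' J < pot' J')%N].
  elim=> [? ? /arcP//|{y z} y z w _ [J [J' [JS J'S -> -> lt]]] _].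
  case=> [K [K' [KS K'S /inj e -> lt']]]; exists J, K'; split => //.
  by apply: ltn_trans lt _; rewrite e.
by move=> x /pathP[J [J' [JS J'S -> /inj ->//]]]; rewrite ltnn.
Qed.

End Collapse.

(** * Linear forms as bare functions *)

Section LinearFunctionals.
Context {R : realFieldType} {V : lmodType R}.
Implicit Types (f g : V -> R).

Definition linear_fun f := forall c x y, f (c *: x + y) = c * f x + f y.

Lemma linfD f : linear_fun f -> {morph f : x y / x + y}.
Proof. by move=> lf x y; rewrite -[x]scale1r lf mul1r scale1r. Qed.

Lemma linf0 f : linear_fun f -> f 0 = 0.
Proof. by move=> lf; have := linfD lf 0 0; rewrite addr0 => ?; lra. Qed.

Lemma linfZ f : linear_fun f -> forall c x, f (c *: x) = c * f x.
Proof. by move=> lf c x; rewrite -[c *: x]addr0 lf linf0 // addr0. Qed.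

Lemma linfN f : linear_fun f -> {morph f : x / - x}.
Proof. by move=> lf x; rewrite -scaleN1r linfZ // mulN1r. Qed.

Lemma linfBZ f : linear_fun f -> forall c x y, f (x - c *: y) = f x - c * f y.
Proof. by move=> lf c x y; rewrite linfD // linfN // linfZ. Qed.

Lemma linear_fun_comb f g c :
  linear_fun f -> linear_fun g -> linear_fun (fun x => f x - c * g x).
Proof. by move=> lf lg k x y; rewrite lf lg; ring. Qed.

End LinearFunctionals.

(** * Polyhedral cones, their faces and their rays *)

Section Cones.
Context {R : realType} {V : lmodType R} {I : finType}.
Context (a : I -> V -> R) (a_lin : forall i, linear_fun (a i)).
Implicit Types (K J G : {set I}) (x y v : V) (f g h : V -> R).

Definition cone K x := forall i, i \in K -> 0 <= a i x.
Definition tight K x : {set I} := [set i in K | a i x == 0].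
(** The points at which all of [K] is tight form the lineality space, so such a linear form descends
    to the quotient by it. *)
Definition vanishes K f := forall x, K \subset tight K x -> f x = 0.

Definition cone_face K J := exists2 x, cone K x & tight K x = J.

(* In a cone homogenizing a polyhedron, with [h] the homogenizing coordinate,
   these are the (homogenized) bounded faces. *)
Definition bounded_face K h J :=
  cone_face K J /\ forall x, cone K x -> J \subset tight K x -> h x <= 0 ->
    K \subset tight K x.

Lemma tightP K x i : reflect (i \in K /\ a i x = 0) (i \in tight K x).
Proof. by rewrite inE; apply: (iffP andP) => -[iK /eqP]. Qed.

Lemma sub_tightP K J x :
  J \subset K -> reflect (forall i, i \in J -> a i x = 0) (J \subset tight K x).
Proof.
move=> /fintype.subsetP JK; apply: (iffP fintype.subsetP) => H i iJ.
  by have /tightP[] := H i iJ.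
by apply/tightP; split; [exact: JK|exact: H].
Qed.

Lemma tight_sub K x : tight K x \subset K.
Proof. by apply/fintype.subsetP => i /tightP[]. Qed.

Lemma tight_gt0 K x i : cone K x -> i \in K -> i \notin tight K x -> 0 < a i x.
Proof.
move=> Kx iK; rewrite inE iK /= => ax0.
by rewrite lt_neqAle eq_sym ax0 Kx.
Qed.

Lemma tight_cone_add K x y : cone K x -> cone K y ->
  tight K (x + y) = tight K x :&: tight K y.
Proof.
move=> Kx Ky; apply/finset.setP => i; rewrite !inE linfD //.
case iK: (i \in K) => //=.
by rewrite paddr_eq0 ?Kx ?Ky.
Qed.

Lemma cone_add K x y : cone K x -> cone K y -> cone K (x + y).
Proof. by move=> Kx Ky i iK; rewrite linfD // addr_ge0 ?Kx ?Ky. Qed.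

Lemma cone_scale K c x : 0 <= c -> cone K x -> cone K (c *: x).
Proof. by move=> c0 Kx i iK; rewrite linfZ // mulr_ge0 // Kx. Qed.

Lemma tight_scale K c x : c != 0 -> tight K (c *: x) = tight K x.
Proof.
by move=> c0; apply/finset.setP => i; rewrite !inE linfZ // mulf_eq0 (negPf c0).
Qed.

Lemma cone_face_sub K J : cone_face K J -> J \subset K.
Proof. by case=> x _ <-; exact: tight_sub. Qed.

(* Moving far along [x] makes every constraint that is slack at [x] slack. *)
Lemma cone_push K x y : cone K x -> cone (tight K x) y ->
  exists N, [/\ 0 < N, cone K (N *: x + y) &
    tight K (N *: x + y) = tight (tight K x) y].
Proof.
move=> Kx Ty.
(* Each summand is the multiple of [x] that compensates [y] in one slack inequality; the added 1
   makes the estimate strict. *)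
pose N := 1 + \sum_(i in K | i \notin tight K x) `|a i y| / a i x.
have term i : i \in K -> i \notin tight K x -> 0 < N * a i x + a i y.
  move=> iK nt; have ax := tight_gt0 Kx iK nt.
  have : 1 + `|a i y| / a i x <= N.
    rewrite /N lerD2l (bigD1 i) ?iK //= lerDl sumr_ge0 // => j.
    by case/andP=> /andP[jK jt] _; rewrite divr_ge0 // Kx.
  rewrite -(ler_pM2r ax) mulrDl mul1r divfK ?gt_eqF // => le.
  have : - `|a i y| <= a i y by rewrite lerNl -normrN ler_norm.
  lra.
have N1 : 1 <= N.
  rewrite lerDl sumr_ge0 // => j /andP[jK jt].
  by rewrite divr_ge0 // Kx.
exists N; split; first lra.
  move=> i iK; rewrite a_lin; have [it|it] := boolP (i \in tight K x).
    by have /tightP[_ ->] := it; rewrite mulr0 add0r Ty.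
  exact/ltW/term.
apply/finset.setP => i; rewrite [LHS]inE [RHS]inE.
have [it|it] := boolP (i \in tight K x).
  by have /tightP[-> ax] := it; rewrite a_lin ax mulr0 add0r.
case iK: (i \in K) => //=.
by rewrite a_lin gt_eqF // term.
Qed.

(** Ratio test: [s] is the least [a i x / a i y] over the inequalities slack at [y], so the first of
    them to become tight stops the motion. *)
Lemma cone_pull K x y : cone K x -> cone K y -> tight K x \subset tight K y ->
  ~~ (K \subset tight K y) ->
  exists s, [/\ 0 < s, cone K (x - s *: y) &
    tight K x \proper tight K (x - s *: y)].
Proof.
move=> Kx Ky xy /fintype.subsetPn[i0 i0K i0y].
have P0 : (i0 \in K) && (i0 \notin tight K y) by rewrite i0K.
case: (@Order.TotalTheory.arg_minP _ _ _ i0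
  (fun i => (i \in K) && (i \notin tight K y)) (fun i => a i x / a i y) P0).
move=> j /andP[jK jy] min.
have nx i : i \notin tight K y -> i \notin tight K x.
  by apply: contra; exact/fintype.subsetP.
have ajy := tight_gt0 Ky jK jy.
have ajx := tight_gt0 Kx jK (nx _ jy).
have aE i : a i (x - a j x / a j y *: y) = a i x - a j x / a j y * a i y.
  exact: linfBZ.
exists (a j x / a j y); split; first exact: divr_gt0.
  move=> i iK; rewrite aE; have [iy|iy] := boolP (i \in tight K y).
    by have /tightP[_ ->] := iy; rewrite mulr0 subr0 Kx.
  have aiy := tight_gt0 Ky iK iy.
  have /min : (i \in K) && (i \notin tight K y) by rewrite iK.
  by rewrite /= ler_pdivlMr // subr_ge0.
apply/fintype.properP; split.
  apply/fintype.subsetP => i ix; apply/tightP; have /tightP[iK ax] := ix.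
  split=> //; rewrite aE ax.
  by have /tightP[_ ->] := fintype.subsetP xy _ ix; rewrite mulr0 subr0.
exists j; last exact: nx.
by apply/tightP; split=> //; rewrite aE divfK ?subrr // gt_eqF.
Qed.

(** Rays are taken modulo the lineality space: the face of [v] consists of multiples of [v] up to
    that space. *)
Definition ray K v := forall y, cone K y -> tight K v \subset tight K y ->
  exists t, K \subset tight K (y - t *: v).

(** A point with [f > 0] whose tight set cannot grow is a ray. Otherwise pulling it along some [y]
    of its face gives [x - s *: y] outside the lineality space with [f <= 0], and pulling [x] along
    that point enlarges the tight set without decreasing [f]. *)
Lemma ray_exists K f x : linear_fun f -> vanishes K f ->
  cone K x -> 0 < f x ->
  exists v, [/\ cone K v, 0 < f v, tight K x \subset tight K v & ray K v].
Proof.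
move=> lf fK; have [n len] := ubnP #|K :\: tight K x|.
elim: n => // n IHn in x len *; move=> Kx fx.
have [[x' [Kx' fx' xx']]|nex] :=
    pselect (exists x', [/\ cone K x', 0 < f x' & tight K x \proper tight K x']).
  have [|v [Kv fv x'v rv]] := IHn x' _ Kx' fx'.
    apply: leq_trans (_ : #|K :\: tight K x| <= n)%N; last by rewrite -ltnS.
    apply: proper_card; have [_ [j jx' jx]] := fintype.properP xx'.
    apply/fintype.properP; split; first exact/finset.setDS/proper_sub.
    exists j; rewrite !finset.in_setD ?jx' ?jx //.
    by have /tightP[->] := jx'.
  exists v; split=> //; exact: fintype.subset_trans (proper_sub xx') x'v.
exists x; split=> // y Ky xy.
have [yK|yK] := boolP (K \subset tight K y).
  by exists 0; rewrite scale0r subr0.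
have [s [s0 Kx' xx']] := cone_pull Kx Ky xy yK.
have [x'K|x'K] := boolP (K \subset tight K (x - s *: y)).
  exists s^-1; apply/sub_tightP => // i iK.
  have /(sub_tightP _ (fintype.subxx _))/(_ i iK) := x'K.
  rewrite !linfBZ // => e.
  have -> : a i x = s * a i y by lra.
  by rewrite mulKf ?gt_eqF // subrr.
exfalso; have [s' [s'0 Kx'' xx'']] := cone_pull Kx Kx' (proper_sub xx') x'K.
have fx' : f (x - s *: y) <= 0.
  by rewrite leNgt; apply/negP => fx'; apply: nex; exists (x - s *: y).
apply: nex; exists (x - s' *: (x - s *: y)); split => //.
rewrite (linfBZ lf).
by have := mulr_ge0_le0 (ltW s'0) fx'; lra.
Qed.

(** The set [P] may be infinite, but [r] factors through the finite type of values of [q]. *)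
Lemma finite_argmin (P : V -> Prop) (q : V -> {set I}) (r : V -> R) :
  (exists v, P v) -> (forall v w, P v -> P w -> q v = q w -> r v = r w) ->
  exists2 v, P v & forall w, P w -> r v <= r w.
Proof.
move=> [v0 Pv0] rq.
pose Q J := `[< exists2 v, P v & q v = J >].
pose rep J := xget v0 (fun v => P v /\ q v = J).
have repP J : Q J -> P (rep J) /\ q (rep J) = J.
  move=> /asboolP[v Pv qv].
  by apply: (@xgetPex _ v0 (fun v => P v /\ q v = J)); exists v.
have Q0 : Q (q v0) by apply/asboolP; exists v0.
case: (Order.TotalTheory.arg_minP (fun J => r (rep J)) Q0) => J QJ min.
exists (rep J); first by have [] := repP _ QJ.
move=> w Pw; have Qw : Q (q w) by apply/asboolP; exists w.
have [Prw qrw] := repP _ Qw.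
by rewrite -(rq (rep (q w)) w) // min.
Qed.

Lemma bounded_face_gt0 K h J x : bounded_face K h J -> cone K x ->
  J \subset tight K x -> ~~ (K \subset tight K x) -> 0 < h x.
Proof. by move=> [_ bJ] Kx Jx; apply: contraNT; rewrite -leNgt; exact: bJ. Qed.

(** The ratio [f / h] is scale invariant, so on rays it depends only on the tight set and has a
    minimum [c]. A point with [f < c * h] would yield a ray with the same inequality, against
    minimality. *)
Lemma lp_min K h f J : linear_fun h -> vanishes K h ->
  linear_fun f -> vanishes K f -> bounded_face K h J -> J != K ->
  exists c x, [/\ cone K x, J \subset tight K x, ~~ (K \subset tight K x),
    f x = c * h x & forall y, cone K y -> J \subset tight K y -> c * h y <= f y].
Proof.
move=> lh hK lf fK bJ JK.
have nontriv g v : vanishes K g -> 0 < g v -> ~~ (K \subset tight K v).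
  by move=> gK gv; apply/negP => /gK e; rewrite e ltxx in gv.
pose P v := [/\ cone K v, J \subset tight K v, 0 < h v & ray K v].
have [v [Kv Jv hv rv] min] : exists2 v, P v & forall w, P w ->
    f v / h v <= f w / h w.
  apply: (@finite_argmin P (tight K) (fun v => f v / h v)).
    have [[x Kx xJ] _] := bJ.
    have hx : 0 < h x.
      apply: (bounded_face_gt0 bJ) => //; rewrite ?xJ //.
      by apply: contra JK => KJ; rewrite finset.eqEsubset KJ -xJ tight_sub.
    have [v [Kv hv xv rv]] := ray_exists lh hK Kx hx.
    by exists v; split => //; rewrite -xJ.
  move=> v w [Kv _ hv rv] [Kw _ hw _] e.
  have [|t wtv] := rv w Kw; first by rewrite e.
  have := fK _ wtv; have := hK _ wtv.
  rewrite (linfBZ lh) (linfBZ lf) => eh ef.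
  have -> : f w = t * f v by lra.
  have eh' : h w = t * h v by lra.
  have t0 : t != 0 by apply: contraTneq hw => t0; rewrite eh' t0 mul0r ltxx.
  by rewrite eh' -mulf_div divff // mul1r.
exists (f v / h v), v; split => //.
- exact: nontriv hK hv.
- by rewrite divfK // gt_eqF.
move=> y Ky Jy; rewrite leNgt; apply/negP => lt.
pose c := f v / h v; pose f' x := f x - c * h x.
have lf' : linear_fun (fun x => - f' x).
  by move=> k x z; rewrite /f' lf lh; ring.
have f'K : vanishes K (fun x => - f' x).
  by move=> x xK; rewrite /f' hK // fK //; ring.
have [|w [Kw f'w yw rw]] := ray_exists lf' f'K Ky.
  by rewrite /f' /c; lra.
have Jw : J \subset tight K w by exact: fintype.subset_trans yw.
have hw : 0 < h w by apply: (bounded_face_gt0 bJ) => //; exact: nontriv f'K f'w.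
have /min : P w by [].
rewrite -/c ler_pdivlMr // => le; rewrite /f' in f'w; lra.
Qed.

Lemma bounded_face_sub K h J G : bounded_face K h J -> cone_face K G ->
  J \subset G -> bounded_face K h G.
Proof.
move=> [_ bJ] fG JG; split=> // x Kx Gx; apply: bJ => //.
exact: fintype.subset_trans Gx.
Qed.

Lemma cone_subK K x : cone K x -> forall G, G \subset K -> cone G x.
Proof. by move=> Kx G /fintype.subsetP GK i /GK/Kx. Qed.

Lemma tight_tight K G x : G \subset K -> tight G x = tight K x :&: G.
Proof.
move=> /fintype.subsetP GK; apply/finset.setP => i; rewrite !inE.
by case iG: (i \in G); rewrite ?andbT ?andbF // GK.
Qed.

(** The inequalities in [G] define the tangent cone at the face [G]; pushing along a relative
    interior point of that face brings its points back into the cone of [K]. *)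
Lemma face_link K G J : cone_face K G -> J \subset G ->
  cone_face G J <-> cone_face K J.
Proof.
move=> fG JG; split=> [[y Gy yJ]|[x Kx xJ]].
  have [x Kx xG] := fG; have [|N [_ KN tN]] := @cone_push K x y Kx.
    by rewrite xG.
  by exists (N *: x + y) => //; rewrite tN xG.
have GK := cone_face_sub fG.
exists x; first exact: cone_subK GK.
by rewrite (@tight_tight K) // xJ; apply/finset.setIidPl.
Qed.

(** * Fibres of the bounded faces over the minimizing faces of [g / h] *)

Section Fibres.
Context (K : {set I}) (h g : V -> R).
Context (lh : linear_fun h) (lg : linear_fun g).
Context (hK : vanishes K h) (gK : vanishes K g).
Context (g_lt0 : forall x, cone K x -> h x = 0 -> 0 <= g x ->
  K \subset tight K x).

(** A relative interior point of the face; the default 0 occurs only when [G] is not a face. *)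
Definition center G := xget 0 (fun x => cone K x /\ tight K x = G).
Definition level G := g (center G) / h (center G).
Definition tilt G x := g x - level G * h x.
(** On these faces [g / h] is constant, so [level] does not depend on the choice of [center]. *)
Definition flat G := [/\ bounded_face K h G, G != K & vanishes G (tilt G)].

Lemma centerP G : cone_face K G -> cone K (center G) /\ tight K (center G) = G.
Proof.
move=> [x Kx xG].
by apply: (@xgetPex _ 0 (fun x => cone K x /\ tight K x = G)); exists x.
Qed.

Lemma center_gt0 G : bounded_face K h G -> G != K -> 0 < h (center G).
Proof.
move=> bG GK; have [Kc cG] := centerP bG.1.
apply: (bounded_face_gt0 bG); rewrite ?cG //.
by apply: contra GK => KG; rewrite finset.eqEsubset KG (cone_face_sub bG.1).
Qed.

Lemma level_center G : bounded_face K h G -> G != K ->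
  g (center G) = level G * h (center G).
Proof. by move=> bG GK; rewrite divfK // gt_eqF // center_gt0. Qed.

Lemma sub_tight_center G : cone_face K G -> G \subset tight G (center G).
Proof.
move=> fG; have [_ cG] := centerP fG.
by rewrite (tight_tight _ (cone_face_sub fG)) cG finset.setIid.
Qed.

Lemma tilt_linear G : linear_fun (tilt G).
Proof. exact: linear_fun_comb. Qed.

(* On the face [J], [g / h] is minimal exactly at the flat face [G], so a point
   of [J] with [h <= 0] could be moved by the center of [G] to one with [h = 0],
   where [g < 0]. *)
Lemma fibre_bounded G J :
  flat G -> bounded_face G (tilt G) J -> bounded_face K h J.
Proof.
move=> [bG GK tG] [fJ bJ]; have JG := cone_face_sub fJ.
have GsK := cone_face_sub bG.1.
have [Kc cG] := centerP bG.1; have hc := center_gt0 bG GK.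
split; first by apply/(face_link bG.1).
move=> x Kx Jx hx.
have s0 : 0 <= - h x / h (center G) by rewrite divr_ge0 ?oppr_ge0 // ltW.
have hz : h (- h x / h (center G) *: center G + x) = 0.
  by rewrite lh divfK ?gt_eqF // addNr.
have Kz : cone K (- h x / h (center G) *: center G + x).
  move=> i iK; rewrite a_lin; apply: addr_ge0; last exact: Kx.
  by apply: mulr_ge0 => //; exact: Kc.
have tx : 0 <= tilt G x.
  have [lt|//] := ltP (tilt G x) 0.
  have xG : G \subset tight G x.
    apply: bJ (ltW lt); first exact: cone_subK GsK.
    by rewrite (tight_tight _ GsK) finset.subsetI Jx.
  by move: lt; rewrite tG // ltxx.
have gz : 0 <= g (- h x / h (center G) *: center G + x).
  have := tilt_linear G (- h x / h (center G)) (center G) x.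
  rewrite (tG _ (sub_tight_center bG.1)) mulr0 add0r.
  by rewrite {1}/tilt hz mulr0 subr0 => ->.
have /(sub_tightP _ (fintype.subxx _)) zK := g_lt0 Kz hz gz.
apply/sub_tightP => // i iK; have := zK i iK; rewrite a_lin.
have := mulr_ge0 s0 (Kc i iK); have := Kx i iK; lra.
Qed.

(** The minimum [c] of [g / h] on [J] is attained along a face [G], obtained as the tight set of a
    minimizer with fewest tight inequalities. *)
Lemma fibre_cover J : bounded_face K h J -> J != K ->
  exists2 G, flat G & bounded_face G (tilt G) J.
Proof.
move=> bJ JK.
have [c [x0 [Kx0 Jx0 x0K fx0 min]]] := lp_min lh hK lg gK bJ JK.
pose f x := g x - c * h x.
have lf : linear_fun f by exact: linear_fun_comb.
have fge0 y : cone K y -> J \subset tight K y -> 0 <= f y.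
  by move=> Ky Jy; rewrite subr_ge0; exact: min.
pose P x := [/\ cone K x, J \subset tight K x & f x = 0].
have P0 : P x0 by split=> //; rewrite /f fx0 subrr.
have [x [Kx Jx fx] xmin] : exists2 x, P x &
    forall y, P y -> (#|tight K x|%:R : R) <= #|tight K y|%:R.
  apply: (@finite_argmin P (tight K) (fun x => #|tight K x|%:R)).
    by exists x0.
  by move=> v w _ _ ->.
pose G := tight K x.
(* The sum of two minimizers is a minimizer whose tight set is the intersection, so [G] lies in the
   tight set of each. *)
have GP y : P y -> G \subset tight K y.
  move=> [Ky Jy fy].
  have /xmin : P (x + y).
    split; first exact: cone_add.
      by rewrite tight_cone_add // finset.subsetI Jx.
    by rewrite linfD // fx fy addr0.
  rewrite tight_cone_add // ler_nat => le; apply/finset.setIidPl/eqP.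
  by rewrite eqEcard finset.subsetIl.
have fG : cone_face K G by exists x.
have bG : bounded_face K h G by exact: bounded_face_sub bJ fG Jx.
have nGK : G != K.
  by apply: contraNneq x0K => e; have := GP _ P0; rewrite e.
(* Pushing along [x] does not change [f], so [f >= 0] on the span of the face; applying this to [y]
   and [- y] gives 0. *)
have fvan : vanishes G f.
  have pos y : G \subset tight G y -> 0 <= f y.
    move=> /(sub_tightP _ (fintype.subxx _)) Gy.
    have [|N [N0 KN tN]] := @cone_push K x y Kx; first by move=> i /Gy ->.
    have := fge0 _ KN; rewrite tN lf fx mulr0 add0r; apply.
    apply: fintype.subset_trans Jx _.
    exact/(sub_tightP _ (fintype.subxx _)).
  move=> y Gy; apply/eqP; rewrite eq_le pos // andbT -oppr_ge0 -linfN //.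
  apply: pos; apply/(sub_tightP _ (fintype.subxx _)) => i iG.
  by rewrite linfN // (sub_tightP _ (fintype.subxx _) Gy) // oppr0.
have tiltE : tilt G = f.
  apply/funext => y; rewrite /tilt /f; congr (_ - _ * _).
  have := fvan _ (sub_tight_center fG); rewrite /f /level => /eqP.
  by rewrite subr_eq0 => /eqP ->; rewrite mulfK // gt_eqF // center_gt0.
exists G; rewrite /flat tiltE //.
split; first by apply/(face_link fG) => //; exact: bJ.1.
move=> y Gy Jy fy.
have [|N [N0 KN tN]] := @cone_push K x y Kx => //.
have fN : f (N *: x + y) = f y by rewrite lf fx mulr0 add0r.
have JN : J \subset tight K (N *: x + y) by rewrite tN.
have PN : P (N *: x + y).
  split=> //; apply/eqP; rewrite fN eq_le fy /= -fN; exact: fge0.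
by have := GP _ PN; rewrite tN.
Qed.

(** The center of [G2] lies in the face [J1], and there [tilt G1] equals [level G2 - level G1] times
    a positive number. If this is at most 0, boundedness of [J1] puts the center on [G1]. *)
Lemma fibre_order G1 G2 J1 J2 : flat G1 -> flat G2 ->
  bounded_face G1 (tilt G1) J1 -> bounded_face G2 (tilt G2) J2 ->
  J1 \subset J2 -> level G2 <= level G1 -> level G1 = level G2 /\ G1 \subset G2.
Proof.
move=> [bG1 G1K t1] [bG2 G2K _] [fJ1 bJ1] [fJ2 _] J12 le.
have J1G1 := cone_face_sub fJ1; have J2G2 := cone_face_sub fJ2.
have G1sK := cone_face_sub bG1.1.
have [Kc cG] := centerP bG2.1; have hc := center_gt0 bG2 G2K.
have tc : tilt G1 (center G2) = (level G2 - level G1) * h (center G2).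
  by rewrite /tilt level_center // mulrBl.
have sub : G1 \subset tight G1 (center G2).
  apply: bJ1; first exact: cone_subK G1sK.
    rewrite (tight_tight _ G1sK) finset.subsetI J1G1 andbT cG.
    exact: fintype.subset_trans J12 J2G2.
  by rewrite tc mulr_le0_ge0 ?subr_le0 // ltW.
split.
  have /eqP := t1 _ sub; rewrite tc mulf_eq0 (gt_eqF hc) orbF subr_eq0.
  by move/eqP.
by move: sub; rewrite (tight_tight _ G1sK) finset.subsetI cG => /andP[].
Qed.

End Fibres.

(** * Induction on the number of inequalities *)

Definition bounded_faces K h : {set {set I}} :=
  [set J | `[< bounded_face K h J >]].

Lemma bounded_facesP K h J :
  reflect (bounded_face K h J) (J \in bounded_faces K h).
Proof. by rewrite inE; exact: asboolP. Qed.

(** The set [K] encodes the lineality space, that is, the empty face after dehomogenization. *)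
Lemma bounded_faceK K h : bounded_face K h K.
Proof.
split; last by [].
exists 0; first by move=> i _; rewrite linf0.
by apply/finset.setP => i; rewrite inE linf0 // eqxx andbT.
Qed.

Lemma bounded_faces_collapse K h x :
  linear_fun h -> vanishes K h -> cone K x -> 0 < h x ->
  exists J0, [/\ bounded_face K h J0, J0 != K,
    forall J, cone_face K J -> J0 \subset J -> J = J0 \/ J = K &
    collapses (bounded_faces K h :\ K :\ J0)].
Proof.
have [n] := ubnP #|K|; elim: n => // n IHn in K h x *.
move=> leKn lh hK Kx hx.
have [v [Kv hv _ rv]] := ray_exists lh hK Kx hx.
pose J0 := tight K v.
have fJ0 : cone_face K J0 by exists v.
have J0sK : J0 \subset K := tight_sub K v.
have J0K : J0 != K.
  by apply: contraTneq hv => e; rewrite hK ?ltxx // -/J0 e.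
have scaled y : cone K y -> J0 \subset tight K y ->
    exists t, forall i, i \in K -> a i y = t * a i v.
  move=> Ky /rv[//|t /(sub_tightP _ (fintype.subxx _)) yt].
  by exists t => i /yt; rewrite linfBZ //; lra.
have bJ0 : bounded_face K h J0.
  split=> // y Ky Jy hy; have [t yt] := rv y Ky Jy.
  have := hK _ yt; rewrite (linfBZ lh) => e.
  have t0 : t <= 0 by rewrite -(pmulr_lle0 _ hv); lra.
  apply/sub_tightP => // i iK; move/(sub_tightP _ (fintype.subxx _)): yt.
  move=> /(_ i iK); rewrite linfBZ // => ei.
  have := mulr_le0_ge0 t0 (Kv i iK); have := Ky i iK; lra.
have minJ0 J : cone_face K J -> J0 \subset J -> J = J0 \/ J = K.
  move=> [y Ky <-] Jy; have [t yt] := scaled y Ky Jy.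
  have [t0|t0] := eqVneq t 0.
    right; apply/eqP; rewrite finset.eqEsubset tight_sub /=.
    by apply/sub_tightP => // i /yt ->; rewrite t0 mul0r.
  left; apply/finset.setP => i; rewrite !inE; case iK: (i \in K) => //=.
  by rewrite yt // mulf_eq0 (negPf t0).
exists J0; split=> //.
pose g y := - \sum_(i in J0) a i y.
have lg : linear_fun g.
  move=> c y z; rewrite /g mulrN -opprD mulr_sumr -big_split /=.
  by congr (- _); apply: eq_bigr => i _; rewrite a_lin.
have gK : vanishes K g.
  move=> y /(sub_tightP _ (fintype.subxx _)) yK; rewrite /g big1 ?oppr0 // => i.
  by move/(fintype.subsetP J0sK)/yK.
have sum_ge0 y : cone K y -> forall i, i \in J0 -> 0 <= a i y.
  by move=> Ky i /(fintype.subsetP J0sK)/Ky.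
have g_le0 y : cone K y -> g y <= 0.
  by move=> /sum_ge0 Ky; rewrite oppr_le0 sumr_ge0.
have g_eq0 y : cone K y -> 0 <= g y -> J0 \subset tight K y.
  move=> Ky gy; have /eqP : g y = 0 by apply/eqP; rewrite eq_le g_le0.
  rewrite oppr_eq0 psumr_eq0; last exact: sum_ge0.
  move/allP => H; apply/sub_tightP => // i iJ.
  by have := H i (mem_index_enum _); rewrite iJ => /eqP.
have g_lt0 y : cone K y -> h y = 0 -> 0 <= g y -> K \subset tight K y.
  by move=> Ky hy /(g_eq0 _ Ky) Jy; apply: bJ0.2; rewrite ?hy.
have gv : g v = 0.
  by rewrite /g big1 ?oppr0 // => i /tightP[].
pose U : {set {set I}} := [set G | `[< flat K h g G >] & G != J0].
pose fib G := bounded_faces G (tilt K h g G).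
have UP G : G \in U -> flat K h g G /\ G != J0.
  by rewrite inE => /andP[/asboolP].
have nsub G : flat K h g G -> G != J0 -> ~~ (J0 \subset G).
  move=> [bG GK _] GJ; apply/negP => /(minJ0 _ bG.1)[] /eqP; exact/negP.
suff -> : bounded_faces K h :\ K :\ J0 = \bigcup_(G in U) fib G.
  apply: (@collapses_bigcup _ _ _ _ (level K h g)).
    move=> G /UP[flG GJ]; have [bG GK tG] := flG.
    have [Kc cG] := centerP bG.1.
    have GsK := cone_face_sub bG.1.
    (* A negative level makes [tilt] positive at [v], as the induction hypothesis requires. *)
    have lt : level K h g G < 0.
      rewrite /level pmulr_llt0 ?invr_gt0 ?center_gt0 //.
      rewrite ltNge; apply/negP => /(g_eq0 _ Kc); rewrite cG.
      exact/negP/nsub.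
    have [|||||J1 [bJ1 J1G minJ1 cJ1]] := IHn G (tilt K h g G) v.
    + apply: (@leq_trans #|K|); last by rewrite -ltnS.
      apply: proper_card.
      by rewrite finset.properEneq GK.
    + exact: tilt_linear.
    + exact: tG.
    + exact: cone_subK GsK.
    + by rewrite /tilt gv sub0r -mulNr mulr_gt0 // oppr_gt0.
    (* In the quotient [G] is the empty face, but for [K] it is a genuine cell; it is paired with
       the vertex [J1] left over by the induction. *)
    have -> : fib G = [set G; J1] :|: (fib G :\ G :\ J1).
      apply/finset.setP => J; rewrite !inE.
      have [->|] := eqVneq J G; first by apply/asboolP; exact: bounded_faceK.
      have [->|] := eqVneq J J1; first by move=> _; apply/asboolP.
      by [].
    apply: collapses_cat => //.
      apply: collapses_pair; rewrite finset.properEneq J1G.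
      exact: cone_face_sub bJ1.1.
    move=> r s; rewrite !inE => /orP[] /eqP -> /and3P[sJ1 sG /asboolP bs].
      apply: contra sG => Gs; rewrite finset.eqEsubset Gs.
      by rewrite (cone_face_sub bs.1).
    apply/negP => /(minJ1 _ bs.1)[] e; first by rewrite e eqxx in sJ1.
    by rewrite e eqxx in sG.
  move=> G1 G2 r s /UP[fl1 _] /UP[fl2 _] /bounded_facesP b1 /bounded_facesP b2.
  exact: fibre_order.
apply/finset.setP => J; rewrite 2!finset.in_setD1; apply/idP/finset.bigcupP.
  case/and3P=> JJ0 JK /bounded_facesP bJ.
  have [G flG bJG] := fibre_cover lh lg hK gK bJ JK.
  exists G; last exact/bounded_facesP.
  rewrite inE; apply/andP; split; first exact/asboolP.
  (* The fibre over [J0] is [J0] alone: its level is 0 and [g <= 0] on the cone, so boundedness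
     forces all of [J] onto the ray. *)
  apply: contra JJ0 => /eqP GJ0; have JG := cone_face_sub bJG.1.
  have [y Ky yJ] := bJ.1.
  have [bG GK tG] := flG; have GsK := cone_face_sub bG.1.
  rewrite -GJ0 finset.eqEsubset JG /=.
  have : G \subset tight G y.
    apply: bJG.2; first exact: cone_subK GsK.
      by rewrite (tight_tight _ GsK) finset.subsetI yJ fintype.subxx.
    have l0 : level K h g G = 0.
      have /tG : G \subset tight G v.
        by rewrite (tight_tight _ GsK) GJ0 finset.setIid.
      rewrite /tilt gv sub0r => /eqP.
      by rewrite oppr_eq0 mulf_eq0 (gt_eqF hv) orbF => /eqP.
    by rewrite /tilt l0 mul0r subr0 g_le0.
  by rewrite (tight_tight _ GsK) finset.subsetI yJ => /andP[].
move=> [G /UP[flG GJ0] /bounded_facesP bJ].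
have JG := cone_face_sub bJ.1.
have bKJ := fibre_bounded lh lg g_lt0 flG bJ.
have [bG GK _] := flG.
apply/and3P; split; last exact/bounded_facesP.
  by apply: contraNneq (nsub _ flG GJ0) => <-.
apply: contra GK => /eqP JK; rewrite finset.eqEsubset (cone_face_sub bG.1).
by rewrite -{1}JK.
Qed.

End Cones.

(** * The scalar product of row vectors *)

Section Dotp.
Context {R : realType} {d : nat}.
Implicit Types (u x : 'rV[R]_d).

Lemma dotp_linear u : linear_fun (dotp u).
Proof.
move=> c x y; rewrite /dotp mulr_sumr -big_split /=.
by apply: eq_bigr => i _; rewrite !mxE; ring.
Qed.

Lemma dotpC u x : dotp u x = dotp x u.
Proof. by apply: eq_bigr => i _; rewrite mulrC. Qed.

Lemma dotp_suml (T : finType) (c : T -> R) (w : T -> 'rV[R]_d) x :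
  dotp (\sum_i c i *: w i) x = \sum_i c i * dotp (w i) x.
Proof.
rewrite dotpC; elim/big_rec2: _ => [|i y z _ <-]; first exact/linf0/dotp_linear.
by rewrite dotp_linear [dotp x (w i)]dotpC.
Qed.

Lemma dotp_delta i x : dotp (delta_mx 0 i) x = x 0 i.
Proof.
rewrite /dotp (bigD1 i) //= mxE !eqxx mul1r big1 ?addr0 // => j ji.
by rewrite mxE (negPf ji) andbF mul0r.
Qed.

End Dotp.

(** * The dome as a slice of its homogenization *)

Section Dome.
Context {R : realType} {d : nat} (A : {fset 'rV[R]_d}) (omega : A -> R).
Context (hA : affinely_spans A).

Let V := ('rV[R]_d * R * R)%type.
Implicit Types (J : {set option A}) (p q : 'rV[R]_d * R) (z : V).

(* The homogenized dome: [Some u] indexes the constraint of the point [u], and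
   [None] the constraint that the homogenizing coordinate is nonnegative. *)
Definition dome_ineq (i : option A) (z : 'rV[R]_d * R * R) : R :=
  if i is Some u then z.2 * omega u + dotp (val u) z.1.1 - z.1.2 else z.2.

Let K : {set option A} := finset.setT.
Let height (z : 'rV[R]_d * R * R) := z.2.
Let C := cone dome_ineq K.
Let tg := tight dome_ineq K.

Lemma dome_ineq_linear i : @linear_fun R V (dome_ineq i).
Proof.
case: i => [u|] c x y //=.
transitivity ((c * x.2 + y.2) * omega u + dotp (val u) (c *: x.1.1 + y.1.1)
  - (c * x.1.2 + y.1.2)) => //.
by rewrite dotp_linear; ring.
Qed.

Lemma height_linear : @linear_fun R V height.
Proof. by []. Qed.

Lemma tgP J z :
  reflect (forall i, i \in J -> dome_ineq i z = 0) (J \subset tg z).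
Proof. by apply: sub_tightP; exact: finset.subsetT. Qed.

Lemma cone_dome p : C (p, 1) <-> dome omega p.
Proof.
split=> [Cp u|Dp [u|] _ //=].
  by have := Cp (Some u) (finset.in_setT _); rewrite /= mul1r; lra.
by have := Dp u; rewrite mul1r; lra.
Qed.

(** The form [dotp _ x] is constantly [s] on [A], hence on all affine combinations of [A], hence
    everywhere; its value at 0 gives [s = 0]. *)
Lemma lineality0 z : K \subset tg z -> z = 0.
Proof.
move=> /tgP zK; case: z zK => [[x s] t] zK.
have t0 : t = 0 by exact: (zK None (finset.in_setT _)).
have zu (u : A) : dotp (val u) x = s.
  by have := zK (Some u) (finset.in_setT _); rewrite /= t0 mul0r; lra.
have dy y : dotp y x = s.
  have [c [c1 ->]] := hA y; rewrite dotp_suml.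
  by under eq_bigr do rewrite zu; rewrite -mulr_suml c1 mul1r.
have s0 : s = 0 by rewrite -(dy 0) dotpC; exact/linf0/dotp_linear.
suff -> : x = 0 by rewrite s0 t0.
by apply/rowP => i; rewrite mxE -dotp_delta dy.
Qed.

Lemma vanishes_all (f : V -> R) : linear_fun f -> vanishes dome_ineq K f.
Proof. by move=> lf z /lineality0 ->; exact: linf0. Qed.

Definition dome_face J : set ('rV[R]_d * R) :=
  fun p => dome omega p /\ J \subset tg (p, 1).

(** The supporting functional is the sum of the inequalities in [J]: a sum of nonnegative slacks
    vanishes only if each of them does. *)
Lemma is_face_dome_face J : None \notin J -> is_face (dome omega) (dome_face J).
Proof.
move=> NJ.
pose lf (p : 'rV[R]_d * R) : R :=
  \sum_(u : A | Some u \in J) (p.2 - dotp (val u) p.1).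
have lf_lin : linear_for *%R lf.
  move=> c p q; rewrite /lf mulr_sumr -big_split /=.
  apply: eq_bigr => u _; rewrite (dotp_linear (val u) c p.1 q.1) /=.
  by rewrite /GRing.scale /=; ring.
pose lm := GRing.isLinear.Build _ _ _ _ lf lf_lin.
pose l : {scalar ('rV[R]_d * R)%type} := HB.pack lf lm.
pose b := \sum_(u : A | Some u \in J) omega u.
have lE p : b - l p = \sum_(u : A | Some u \in J) dome_ineq (Some u) (p, 1).
  rewrite /b /= /lf -sumrB; apply: eq_bigr => u _ /=; ring.
have ge0 p : dome omega p ->
    forall u : A, Some u \in J -> 0 <= dome_ineq (Some u) (p, 1).
  by move=> /cone_dome Cp u _; exact: Cp.
exists l, b; split=> [p Dp|].
  by rewrite -subr_ge0 lE sumr_ge0 //; exact: ge0.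
apply/seteqP; split=> p [Dp Hp]; split=> //.
  apply/esym/eqP; rewrite -subr_eq0 lE big1 // => u uJ.
  exact: (tgP _ _ Hp).
apply/tgP => -[u|] iJ; last by rewrite iJ in NJ.
have /eqP := lE p; rewrite Hp subrr eq_sym psumr_eq0; last exact: ge0.
by move=> /allP/(_ u (mem_index_enum _)); rewrite iJ => /eqP.
Qed.

Lemma bounded_face_point J : bounded_face dome_ineq K height J -> J != K ->
  exists2 p, dome omega p & tg (p, 1) = J.
Proof.
move=> bJ JK; have [[z Cz zJ] _] := bJ.
have hz : 0 < z.2.
  apply: (bounded_face_gt0 bJ) => //; first by rewrite zJ.
  by apply: contra JK => KJ; rewrite finset.eqEsubset finset.subsetT -zJ.
have e : z.2^-1 *: z = (z.2^-1 *: z.1, 1 : R).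
  case: z hz {Cz zJ} => z t /= hz; congr pair.
  by rewrite /GRing.scale /= mulVf // gt_eqF.
exists (z.2^-1 *: z.1).
  apply/cone_dome; rewrite -e; apply: cone_scale => //.
    exact: dome_ineq_linear.
  by rewrite invr_ge0 ltW.
rewrite -e -zJ; apply: tight_scale; first exact: dome_ineq_linear.
by rewrite invr_eq0 gt_eqF.
Qed.

Lemma bounded_face_None J : bounded_face dome_ineq K height J -> J != K ->
  None \notin J.
Proof.
move=> bJ JK; have [p _ <-] := bounded_face_point bJ JK.
by apply/negP => /tightP[_ /= /eqP]; rewrite oner_eq0.
Qed.

(** Otherwise the downward direction of the dome would lie in the face. *)
Lemma bounded_face_Some J : bounded_face dome_ineq K height J -> J != K ->
  exists u : A, Some u \in J.
Proof.
move=> bJ JK; apply: contrapT => nJ.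
pose z : V := ((0, -1), 0).
have zu (u : A) : dome_ineq (Some u) z = 1.
  by rewrite /= (linf0 (dotp_linear _)); ring.
have Cz : C z by case=> [u|] _; rewrite ?zu ?ler01 //=.
have Jz : J \subset tg z.
  by apply/tgP => -[u|//] uJ; exfalso; apply: nJ; exists u.
have /tgP Kz := bJ.2 _ Cz Jz (lexx _).
(* Coefficients with sum 1 show that [A] is nonempty. *)
have [c [c1 _]] := hA 0.
suff : (1 : R) = 0 by move/eqP; rewrite oner_eq0.
rewrite -c1 big1 // => u _.
have := Kz (Some u) (finset.in_setT _); rewrite zu => /eqP.
by rewrite oner_eq0.
Qed.

(** Each coordinate and its negative are bounded below by a multiple of the height, which is 1
    here. *)
Lemma bounded_dome_face J : bounded_face dome_ineq K height J -> J != K ->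
  bounded_set (dome_face J).
Proof.
move=> bJ JK.
have lp (f : V -> R) : linear_fun f ->
    exists M, forall p, dome_face J p -> `|f (p, 1)| <= M.
  move=> lf; have lf' : linear_fun (fun z => - f z).
    by move=> c x y; rewrite lf; ring.
  have [c [? [_ _ _ _ Hc]]] := lp_min dome_ineq_linear height_linear
    (vanishes_all height_linear) lf (vanishes_all lf) bJ JK.
  have [c' [? [_ _ _ _ Hc']]] := lp_min dome_ineq_linear height_linear
    (vanishes_all height_linear) lf' (vanishes_all lf') bJ JK.
  exists (`|c| + `|c'|) => p [/cone_dome Cp Jp].
  have := Hc _ Cp Jp; have := Hc' _ Cp Jp; rewrite /height !mulr1 => h1 h2.
  have := ler_norm (- c); have := ler_norm (- c'); rewrite !normrN => h3 h4.
  have := normr_ge0 c; have := normr_ge0 c' => h5 h6.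
  rewrite ler_norml; apply/andP; split; lra.
have [M HM] : exists M : 'I_d -> R,
    forall i p, dome_face J p -> `|p.1 0 i| <= M i.
  have [M HM] := choice (fun i => lp (fun z => z.1.1 0 i)
    (fun c x y => ltac:(by rewrite /= !mxE))).
  by exists M.
have [M' HM'] := lp (fun z => z.1.2) (fun c x y => erefl).
exists (\sum_i `|M i| + `|M'|); split; first exact: num_real.
move=> B ltB p Fp; apply: le_trans (ltW ltB).
rewrite prod_normE ge_max; apply/andP; split.
  have [->|/mx_norm_neq0[[j i] /= e]] := eqVneq (`|p.1|) 0.
    by rewrite addr_ge0 // sumr_ge0.
  apply: (@le_trans _ _ `|p.1 j i|); first by rewrite -e; exact: lexx.
  rewrite (ord1 j); apply: le_trans (HM i _ Fp) _.
  apply: le_trans (ler_norm _) _; rewrite (bigD1 i) //= -addrA lerDl.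
  by rewrite addr_ge0 // sumr_ge0.
apply: le_trans (HM' _ Fp) _; apply: le_trans (ler_norm _) _.
by rewrite lerDr sumr_ge0.
Qed.

(** The set [J] is the tight set of a relative interior point [p0] of [F], found as a point with
    fewest tight inequalities. *)
Lemma faceP (F : set ('rV[R]_d * R)) :
  is_face (dome omega) F -> (F !=set0)%classic -> bounded_set F ->
  exists J, [/\ bounded_face dome_ineq K height J, J != K & F = dome_face J].
Proof.
move=> [l [b [lb FE]]] [q0 Fq0] bF.
have [p0 Fp0 min] : exists2 p, F p & forall q, F q ->
    (#|tg (p, 1)|%:R : R) <= #|tg (q, 1)|%:R.
  apply: (@finite_argmin _ _ _ F (fun p => tg (p, 1))
    (fun p => #|tg (p, 1)|%:R)).
    by exists q0.
  by move=> v w _ _ ->.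
pose J := tg (p0, 1).
have [Dp0 lp0] : dome omega p0 /\ l p0 = b by move: Fp0; rewrite FE.
have /cone_dome Cp0 := Dp0.
have FJ : F = dome_face J.
  apply/seteqP; split=> q.
    move=> Fq; have [Dq lq] : dome omega q /\ l q = b by move: Fq; rewrite FE.
    split=> //; have /cone_dome Cq := Dq.
    (* The midpoint stays in [F], and its tight set is the intersection of those of [p0] and [q]. *)
    have e : (2^-1 *: (p0 + q), 1) = 2^-1 *: ((p0, 1) + (q, 1)) :> V.
      by congr pair; rewrite /GRing.scale /=; lra.
    have Ce : C (2^-1 *: (p0 + q), 1).
      rewrite e; apply: cone_scale; [exact: dome_ineq_linear|lra|].
      by apply: cone_add => //; exact: dome_ineq_linear.
    have /min : F (2^-1 *: (p0 + q)).
      rewrite FE; split; first exact/cone_dome.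
      by rewrite linearZ linearD /= lp0 lq /GRing.scale /=; lra.
    rewrite e /tg (tight_scale dome_ineq_linear) ?invr_eq0 ?pnatr_eq0 //.
    rewrite (tight_cone_add dome_ineq_linear) // ler_nat => le.
    by apply/finset.setIidPl/eqP; rewrite eqEcard finset.subsetIl.
  move=> [Dq Jq]; rewrite FE; split=> //; apply/eqP; rewrite eq_le lb //=.
  have /cone_dome Cq := Dq.
  (* The segment from [q] to [p0] extends beyond [p0] to [p0 + N^-1 *: (p0 - q)], where [l <= b]
     forces [l q >= b]. Adding [(p0, 1)] makes the height exactly [N]. *)
  have [|N [N0 CN _]] := cone_push dome_ineq_linear (y := - (q, 1) : V) Cp0.
    move=> i iJ; rewrite linfN; last exact: dome_ineq_linear.
    by rewrite (tgP _ _ Jq) // oppr0.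
  have C' := cone_add dome_ineq_linear Cp0 CN.
  have e : N^-1 *: ((p0, 1) + (N *: (p0, 1) - (q, 1))) =
      (N^-1 *: (p0 + (N *: p0 - q)), 1) :> V.
    congr pair; transitivity (N^-1 * (1 + (N * 1 - 1))) => //.
    by rewrite mulr1 addrCA subrr addr0 mulVf // gt_eqF.
  have /cone_dome/lb : C (N^-1 *: (p0 + (N *: p0 - q)), 1).
    rewrite -e; apply: cone_scale => //; first exact: dome_ineq_linear.
    by rewrite invr_ge0 ltW.
  rewrite linearZ linearD linearB linearZ /= lp0 /GRing.scale /=.
  by rewrite ler_pdivrMl //; lra.
exists J; split=> //; last first.
  apply/eqP => e; have : None \in J by rewrite e finset.in_setT.
  by case/tightP=> _ /= /eqP; rewrite oner_eq0.
split; first by exists (p0, 1).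
move=> z Cz Jz hz.
have z2 : z.2 = 0.
  by apply/eqP; rewrite eq_le hz /=; exact: (Cz None (finset.in_setT _)).
have Fc (c : R) : 0 <= c -> F (c *: z.1 + p0).
  move=> c0; have e : c *: z + (p0, 1) = (c *: z.1 + p0, 1) :> V.
    case: z z2 {Cz Jz hz} => z t /= ->; congr pair.
    by transitivity (c * 0 + 1) => //; rewrite mulr0 add0r.
  rewrite FJ; split.
    apply/cone_dome; rewrite -e; apply: cone_add => //.
      exact: dome_ineq_linear.
    by apply: cone_scale => //; exact: dome_ineq_linear.
  rewrite -e; apply/tgP => i iJ; rewrite dome_ineq_linear (tgP _ _ Jz) //.
  by rewrite mulr0 add0r; have /tightP[] := iJ.
have [M [_ HM]] := bF.
have z1 : z.1 = 0.
  apply/eqP; rewrite -normr_eq0 eq_le normr_ge0 andbT leNgt; apply/negP => z1.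
  (* With this [c] the norm of [c *: z.1] exceeds [M + 1] by more than the norm of [p0]. *)
  pose c := (`|M| + 2 + `|p0|) / `|z.1|.
  have c0 : 0 <= c by rewrite divr_ge0 // !addr_ge0.
  have le : `|c *: z.1 + p0| <= M + 1 by apply: HM (Fc _ c0); lra.
  have : `|c *: z.1| <= `|c *: z.1 + p0| + `|p0|.
    by rewrite -[X in `|X| <= _](addrK p0) ler_normB.
  rewrite normrZ ger0_norm // divfK ?gt_eqF //.
  have := ler_norm M; lra.
have -> : z = 0 by case: z z1 z2 {Cz Jz hz Fc} => ? ? /= -> ->.
by apply/tgP => i _; exact/linf0/dome_ineq_linear.
Qed.

(** Some point of [A] is tight on each bounded face, so the face lies on the upper boundary of the
    dome, where the projection is injective. *)
Lemma dome_face_proj_sub J J' :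
  bounded_face dome_ineq K height J -> J != K ->
  bounded_face dome_ineq K height J' -> J' != K ->
  (fst @` dome_face J `<=` fst @` dome_face J')%classic <-> J' \subset J.
Proof.
move=> bJ JK bJ' JK'; split=> [sub|sub _ [p [Dp Jp] <-]]; last first.
  by exists p => //; split=> //; exact: fintype.subset_trans Jp.
have [p Dp pJ] := bounded_face_point bJ JK.
have [|q [Dq Jq] qp] := sub p.1.
  by exists p => //; split=> //; rewrite pJ.
have [u uJ] := bounded_face_Some bJ JK.
have [u' uJ'] := bounded_face_Some bJ' JK'.
have q2 : q.2 = p.2.
  have := tgP _ _ Jq _ uJ'; have := Dp u'; have := Dq u.
  have : dome_ineq (Some u) (p, 1) = 0.
    by move: uJ; rewrite -pJ => /tightP[].
  by rewrite /= qp; lra.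
have qpE : q = p by case: q p qp q2 {Dq Jq Dp pJ} => ? ? [? ?] /= -> ->.
by rewrite -pJ -qpE.
Qed.

Lemma dome_point : exists2 z : V, C z & 0 < height z.
Proof.
exists ((0, - \sum_u `|omega u|), 1); last exact: ltr01.
apply/cone_dome => u /=; rewrite (linf0 (dotp_linear _)) addr0.
rewrite lerNl; apply: le_trans (ler_norm _) _; rewrite normrN.
by rewrite (bigD1 u) //= lerDl sumr_ge0.
Qed.

End Dome.

Theorem theorem4p2 (R : realType) (d : nat) (A : {fset 'rV[R]_d}) (omega : A -> R)
    (hA : affinely_spans A) :
  collapsible (tight_span omega).
Proof.
pose K : {set option A} := finset.setT.
have [z Cz hz] := dome_point omega.
have [J0 [bJ0 J0K minJ0 cJ0]] := bounded_faces_collapse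
  (dome_ineq_linear omega) (height_linear (d := d))
  (vanishes_all hA (height_linear (d := d))) Cz hz.
(* Removing [K] discards the empty face, which is not a cell. *)
pose S := bounded_faces (dome_ineq omega) K snd :\ K.
have SP J : J \in S <-> J != K /\ bounded_face (dome_ineq omega) K snd J.
  rewrite finset.in_setD1.
  by split=> [/andP[JK /bounded_facesP]|[-> /bounded_facesP]].
apply: (@collapsible_of_collapses _ _ _
  (fun J => fst @` dome_face omega J)%classic S J0).
- exact/SP.
- exact: cJ0.
- by move=> J /SP[JK bJ] /(minJ0 _ bJ.1)[//|e]; rewrite e eqxx in JK.
- move=> J J' /SP[JK bJ] /SP[JK' bJ'].
  exact: dome_face_proj_sub hA _ _ bJ JK bJ' JK'.
move=> sigma; split=> [[F [fF F0 bF ->]]|[J /SP[JK bJ] ->]].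
  by have [J [bJ JK ->]] := faceP fF F0 bF; exists J => //; apply/SP.
exists (dome_face omega J); split=> //.
- by apply: is_face_dome_face; exact: bounded_face_None bJ JK.
- by have [p Dp pJ] := bounded_face_point bJ JK; exists p; split; rewrite ?pJ.
- exact: bounded_dome_face bJ JK.
Qed.
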